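(* Let $f:\mathbb{R}^n\to\mathbb{R}$, let $Q_\alpha$ be a quadratic function on $\mathbb{R}^n$, and let $\mathcal{X}=\{\boldsymbol{x}_1,\dots,\boldsymbol{x}_m\}\subset\mathbb{R}^n$ be a poised set, where $n+1\le m<\frac12(n+1)(n+2)$. Then for any $C_1,C_2\in\mathbb{R}$, $$\mathcal{M}^{\mathcal{X}}_{Q_\alpha}(C_1f+C_2)=\big(C_1\mathcal{M}^{\mathcal{X}}_{Q_\alpha}(f)+C_2\big)+(C_1-1)\big(\mathcal{M}^{\mathcal{X}}_{0}(Q_\alpha)-Q_\alpha\big),$$ where $\mathcal{M}^{\mathcal{X}}_0(Q_\alpha)$ is the least Frobenius norm updating model of $Q_\alpha$ on $\mathcal{X}$ based on the zero function.
   Context: A quadratic function on $\mathbb{R}^n$ is a polynomial of degree at most $2$. A set $\mathcal{X}=\{\boldsymbol{x}_1,\dots,\boldsymbol{x}_m\}\subset\mathbb{R}^n$ is poised if its KKT matrix $\boldsymbol{W}=\begin{pmatrix}\boldsymbol{A}&\boldsymbol{X}^\top\\ \boldsymbol{X}&\boldsymbol{0}\end{pmatrix}\in\mathbb{R}^{(m+n+1)\times(m+n+1)}$ is invertible, where, for a base point $\boldsymbol{x}_0\in\mathbb{R}^n$, $\boldsymbol{A}_{ij}=\frac12\big((\boldsymbol{x}_i-\boldsymbol{x}_0)^\top(\boldsymbol{x}_j-\boldsymbol{x}_0)\big)^2$ for $1\le i,j\le m$ and $\boldsymbol{X}\in\mathbb{R}^{(n+1)\times m}$ has $j$-th column $(1,(\boldsymbol{x}_j-\boldsymbol{x}_0)^\top)^\top$.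 For a poised $\mathcal{X}$ with $n+1\le|\mathcal{X}|<\frac12(n+1)(n+2)$, a quadratic function $Q_\alpha$ and $h:\mathbb{R}^n\to\mathbb{R}$, the least Frobenius norm updating model of $h$ on $\mathcal{X}$ based on $Q_\alpha$, denoted $\mathcal{M}^{\mathcal{X}}_{Q_\alpha}(h)$, is the (unique) solution of: minimize $\|\nabla^2Q-\nabla^2Q_\alpha\|_F^2$ over quadratic functions $Q$ subject to $Q(\boldsymbol{x})=h(\boldsymbol{x})$ for all $\boldsymbol{x}\in\mathcal{X}$. *)

(* Defs.v *)
From HB Require Import structures.
From mathcomp Require Import all_boot all_order all_algebra.
From mathcomp Require Import boolp classical_sets reals.
From mathcomp Require Import mpoly.

Set Implicit Arguments.
Unset Strict Implicit.
Unset Printing Implicit Defensive.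

Import Order.TTheory GRing.Theory Num.Theory.
Local Open Scope ring_scope.

Section Interpolation.
Variables (R : realType) (n : nat).

(* [msize] is one more than the total degree (and 0 for the zero polynomial). *)
Definition quadratic (Q : {mpoly R[n]}) : bool := (msize Q <= 3)%N.

Definition eval (Q : {mpoly R[n]}) (v : 'cV[R]_n) : R := Q.@[fun i => v i 0].

Definition hessian (Q : {mpoly R[n]}) (v : 'cV[R]_n) : 'M[R]_n :=
  \matrix_(i, j) eval (mderiv j (mderiv i Q)) v.

Definition frobenius_norm (H : 'M[R]_n) : R :=
  Num.sqrt (\sum_i \sum_j H i j ^+ 2).

Section Points.
Variables (m : nat) (x : 'I_m -> 'cV[R]_n).

Definition kkt_A (x0 : 'cV[R]_n) : 'M[R]_m :=
  \matrix_(i, j) (2^-1 * (((x i - x0)^T *m (x j - x0)) 0 0) ^+ 2).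

Definition kkt_X (x0 : 'cV[R]_n) : 'M[R]_(1 + n, m) :=
  \matrix_(k, j) (col_mx (1%:M : 'cV[R]_1) (x j - x0)) k 0.

Definition kkt_mx (x0 : 'cV[R]_n) : 'M[R]_(m + (1 + n)) :=
  block_mx (kkt_A x0) (kkt_X x0)^T (kkt_X x0) 0.

(* Two equal points would give two equal rows of [kkt_mx x0], so a poised
   family is automatically injective and [m] is the number of points. *)
Definition poised (x0 : 'cV[R]_n) : bool := kkt_mx x0 \in unitmx.

Definition interpolates (h : 'cV[R]_n -> R) (Q : {mpoly R[n]}) : Prop :=
  forall i, eval Q (x i) = h (x i).

(* The Hessian of a quadratic function does not depend on the point, hence the
   evaluation at the origin. *)
Definition objective (Qa Q : {mpoly R[n]}) : R :=
  frobenius_norm (hessian Q 0 - hessian Qa 0) ^+ 2.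

Definition least_frobenius_solution (Qa : {mpoly R[n]}) (h : 'cV[R]_n -> R)
    (Q : {mpoly R[n]}) : Prop :=
  [/\ quadratic Q, interpolates h Q
    & forall Q', quadratic Q' -> interpolates h Q' ->
        objective Qa Q <= objective Qa Q'].

(* Selects the solution of the minimization problem, which exists and is unique
   when the points are poised; the default 0 is returned if there is none. *)
Definition model (Qa : {mpoly R[n]}) (h : 'cV[R]_n -> R) : {mpoly R[n]} :=
  xget 0 [set Q | least_frobenius_solution Qa h Q]%classic.

End Points.
End Interpolation.

(* Main.v *)
(* A quadratic Q that interpolates h is the least Frobenius norm updating model
   based on Qa as soon as the Hessian of Q - Qa is Frobenius-orthogonal to the
   Hessians of all quadratics vanishing on the points: this gives a Pythagorean
   identity for the objective, and a quadratic vanishing on the points with zero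
   Hessian is affine, hence zero by poisedness.  Solving the KKT system produces
   such a Q.  The orthogonality condition is linear in Q - Qa, and so holds for
   the right-hand side of the theorem, which visibly interpolates C1 f + C2. *)

Require Import Defs.
From HB Require Import structures.
From mathcomp Require Import all_boot all_order all_algebra.
From mathcomp Require Import boolp classical_sets reals.
From mathcomp Require Import mpoly.
From mathcomp Require Import ring lra.

Set Implicit Arguments.
Unset Strict Implicit.
Unset Printing Implicit Defensive.

Import Order.TTheory GRing.Theory Num.Theory.
Local Open Scope ring_scope.

(** * Linearity of the Hessian on quadratic polynomials *)

Section QuadraticPolynomials.
Variables (R : realType) (n : nat).
Implicit Types (P Q : {mpoly R[n]}) (v y b : 'cV[R]_n) (A B H : 'M[R]_n).

Lemma quadraticD P Q : quadratic P -> quadratic Q -> quadratic (P + Q).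
Proof.
move=> qP qQ; apply: leq_trans (msizeD_le _ _) _.
by rewrite geq_max; apply/andP.
Qed.

Lemma quadraticZ (c : R) P : quadratic P -> quadratic (c *: P).
Proof. exact/leq_trans/msizeZ_le. Qed.

Lemma quadraticB P Q : quadratic P -> quadratic Q -> quadratic (P - Q).
Proof. by move=> qP qQ; apply: quadraticD => //; rewrite /quadratic msizeN. Qed.

Lemma quadraticC (c : R) : quadratic (c%:MP : {mpoly R[n]}).
Proof. by rewrite /quadratic msizeC; case: (c != 0). Qed.

Lemma hessianD P Q v : hessian (P + Q) v = hessian P v + hessian Q v.
Proof. by apply/matrixP => i j; rewrite !mxE !mderivD /eval mevalD. Qed.

Lemma hessianZ (c : R) P v : hessian (c *: P) v = c *: hessian P v.
Proof. by apply/matrixP => i j; rewrite !mxE !mderivZ /eval mevalZ. Qed.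

Lemma hessianB P Q v : hessian (P - Q) v = hessian P v - hessian Q v.
Proof. by rewrite hessianD -[- Q]scaleN1r hessianZ scaleN1r. Qed.

Lemma hessianC (c : R) v : hessian c%:MP v = 0.
Proof. by apply/matrixP => i j; rewrite !mxE mderivC mderiv0 /eval meval0. Qed.

Lemma hessian0 v : hessian (0 : {mpoly R[n]}) v = 0.
Proof. by rewrite -mpolyC0 hessianC. Qed.

Lemma hessian_sum (I : finType) (F : I -> {mpoly R[n]}) v :
  hessian (\sum_i F i) v = \sum_i hessian (F i) v.
Proof.
elim/big_ind2: _ => [|P1 P2 Q1 Q2 <- <-|//]; last by rewrite hessianD.
by rewrite hessian0.
Qed.

(** * Second-order Taylor polynomial at the origin *)

Definition taylor2 P : {mpoly R[n]} :=
  (eval P 0)%:MP + \sum_i eval P^`M(i) 0 *: 'X_i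
  + 2^-1 *: \sum_i \sum_j hessian P 0 i j *: ('X_i * 'X_j).

(** Linearity reduces the identity [taylor2 P = P] for quadratics to the monomials of degree at most
    2. *)
Lemma taylor2_is_linear (c : R) P Q :
  taylor2 (c *: P + Q) = c *: taylor2 P + taylor2 Q.
Proof.
rewrite /taylor2 hessianD hessianZ /eval mevalD mevalZ.
rewrite mpolyCD mpolyCM mul_mpolyC.
under eq_bigr do rewrite mderivD mderivZ mevalD mevalZ scalerDl -scalerA.
rewrite big_split /= -scaler_sumr.
under [X in 2^-1 *: X]eq_bigr => i _.
  under eq_bigr do rewrite [(_ + _ : 'M_n) i _]mxE [(c *: _ : 'M_n) i _]mxE
    scalerDl -scalerA.
  rewrite big_split /= -scaler_sumr; over.
rewrite big_split /= -scaler_sumr -!mul_mpolyC. ring.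
Qed.

Lemma mderivXU (i j : 'I_n) : ('X_j : {mpoly R[n]})^`M(i) = (i == j)%:R%:MP.
Proof.
rewrite mderivX mnm1E eq_sym; case: eqP => [->|_]; last
  by rewrite scale0r mpolyC0.
by rewrite scale1r -[X in (X - _)%MM]add0m addmK mpolyX0.
Qed.

Lemma taylor2C (c : R) : taylor2 c%:MP = c%:MP.
Proof.
rewrite /taylor2 hessianC /eval mevalC.
rewrite big1 => [|k _]; last by rewrite mderivC meval0 scale0r.
rewrite addr0 big1 ?scaler0 ?addr0// => k _.
by rewrite big1// => l _; rewrite mxE scale0r.
Qed.

Lemma taylor2XU (i : 'I_n) : taylor2 'X_i = 'X_i.
Proof.
rewrite /taylor2 /eval mevalXU mxE add0r.
rewrite (bigD1 i)//= mderivXU eqxx mevalC scale1r big1 => [|k /negPf ki].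
  rewrite addr0 big1 ?scaler0 ?addr0// => k _.
  by rewrite big1// => l _; rewrite mxE mderivXU mderivC /eval meval0 scale0r.
by rewrite mderivXU ki mevalC scale0r.
Qed.

(** The sum of two indicators also covers [i = j], where it gives the entry 2. *)
Lemma hessianXX (i j k l : 'I_n) v : hessian ('X_i * 'X_j) v k l =
  ((k == i) && (l == j))%:R + ((k == j) && (l == i))%:R :> R.
Proof.
rewrite mxE mderivM !mderivXU mderivD !mderivM !mderivC !mderivXU.
rewrite mul0r mulr0 addr0 add0r /eval mevalD !mevalM !mevalC -!natrM !mulnb.
by rewrite [(l == i) && _]andbC.
Qed.

Lemma taylor2XX (i j : 'I_n) : taylor2 ('X_i * 'X_j) = 'X_i * 'X_j.
Proof.
rewrite /taylor2 /eval mevalM mevalXU mxE mul0r add0r.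
rewrite big1 ?add0r => [|k _]; last first.
  by rewrite mderivM mevalD !mevalM !mevalXU !mxE mulr0 mul0r addr0 scale0r.
(* Each indicator of [hessianXX] contributes one copy of the monomial; the factor 1/2 compensates
   for the two copies. *)
have sumE p q : \sum_k \sum_l ((k == p) && (l == q))%:R *: ('X_k * 'X_l) =
    'X_p * 'X_q :> {mpoly R[n]}.
  rewrite (bigD1 p)//= [X in _ + X]big1 => [|k /negPf kp]; last first.
    by rewrite big1// => l _; rewrite kp scale0r.
  rewrite (bigD1 q)//= big1 => [|k /negPf kq]; last by rewrite kq andbF scale0r.
  by rewrite !eqxx scale1r !addr0.
under eq_bigr => k _.
  under eq_bigr do rewrite hessianXX scalerDl.
  rewrite big_split; over.
rewrite big_split /= !sumE ['X_j * _]mulrC -mulr2n -scaler_nat scalerA.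
by rewrite mulVf ?pnatr_eq0// scale1r.
Qed.

Lemma mdeg_gt0P (t : 'X_{1..n}) : (0 < mdeg t)%N ->
  exists i, t = (U_(i) + (t - U_(i)))%MM.
Proof.
rewrite lt0n mdeg_eq0 => t0; suff [i ti] : exists i, t i != 0%N.
  by exists i; rewrite addmC submK// lep1mP.
apply/existsP; apply: contraNT t0 => /existsPn t0.
by apply/eqP/mnmP => i; rewrite mnm0E; apply/eqP; rewrite -[_ == _]negbK.
Qed.

(** Variables are peeled off a monomial of degree at most 2, which leaves the cases 1, ['X_i] and
    ['X_i * 'X_j]. *)
Lemma taylor2_quadratic P : quadratic P -> taylor2 P = P.
Proof.
move=> qP; have tX (t : 'X_{1..n}) : (mdeg t < 3)%N ->
    taylor2 'X_[t] = 'X_[t].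
  have [/eqP|/mdeg_gt0P[i ti]] := posnP (mdeg t).
    by rewrite mdeg_eq0 => /eqP -> _; rewrite mpolyX0 -mpolyC1 taylor2C.
  move: ti; set s := (t - U_(i))%MM => ->; rewrite mdegD mdeg1 add1n ltnS.
  have [/eqP|/mdeg_gt0P[j sj]] := posnP (mdeg s).
    by rewrite mdeg_eq0 => /eqP -> _; rewrite addm0 taylor2XU.
  rewrite sj mdegD mdeg1 add1n !ltnS leqn0 mdeg_eq0 => /eqP ->.
  by rewrite addm0 mpolyXD taylor2XX.
have t0 : taylor2 0 = 0 by rewrite -mpolyC0 taylor2C.
rewrite (mpolyE P) big_seq; elim/big_rec: _ => // t Q tP IH.
by rewrite taylor2_is_linear IH tX// (leq_trans (msize_mdeg_lt tP)).
Qed.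

(** * Expansion of the values of a quadratic around a point *)

Lemma evalD P Q v : eval (P + Q) v = eval P v + eval Q v.
Proof. exact: mevalD. Qed.
Lemma evalB P Q v : eval (P - Q) v = eval P v - eval Q v.
Proof. exact: mevalB. Qed.
Lemma evalZ (c : R) P v : eval (c *: P) v = c * eval P v.
Proof. exact: mevalZ. Qed.
Lemma evalC (c : R) v : eval c%:MP v = c.
Proof. exact: mevalC. Qed.
Lemma eval_sum (I : finType) (F : I -> {mpoly R[n]}) v :
  eval (\sum_i F i) v = \sum_i eval (F i) v.
Proof. exact: raddf_sum. Qed.

Lemma quadratic_evalE P v : quadratic P ->
  eval P v = eval P 0 + \sum_i eval P^`M(i) 0 * v i 0
             + 2^-1 * (v^T *m hessian P 0 *m v) 0 0.
Proof.
move=> qP; rewrite -{1}(taylor2_quadratic qP) /taylor2.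
rewrite !evalD evalC evalZ !eval_sum.
congr (_ + _ + _ * _).
  by apply: eq_bigr => i _; rewrite evalZ /eval mevalXU.
under eq_bigr do rewrite eval_sum.
rewrite exchange_big mxE; apply: eq_bigr => j _ /=.
rewrite mxE mulr_suml; apply: eq_bigr => i _.
by rewrite evalZ /eval mevalM !mevalXU [v^T _ _]mxE; ring.
Qed.

Lemma trmx11E (A : 'M[R]_1) : A^T 0 0 = A 0 0.
Proof. by rewrite mxE. Qed.

(** Only the affine shape of the lower-order part matters later, so its coefficients stay
    existential, while the Hessian is kept explicit. *)
Lemma quadratic_expand P v : quadratic P -> exists a b, forall y,
  eval P (v + y) = a + (y^T *m b) 0 0 + 2^-1 * (y^T *m hessian P 0 *m y) 0 0.
Proof.
move=> qP; pose H := hessian P 0; pose g := \col_i eval P^`M(i) 0.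
have gE (u : 'cV[R]_n) : \sum_i eval P^`M(i) 0 * u i 0 = (u^T *m g) 0 0.
  by rewrite mxE; apply: eq_bigr => i _; rewrite !mxE mulrC.
(* The witnesses are the value and the gradient of [P] at [v]. *)
exists (eval P v), (g + 2^-1 *: ((H + H^T) *m v)) => y.
rewrite (quadratic_evalE (v + y) qP) (quadratic_evalE v qP) -/H.
rewrite !gE [(v + y)^T]raddfD /=.
rewrite !(mulmxDl, mulmxDr) -scalemxAr mulmxDr.
have -> : v^T *m H *m y = (y^T *m (H^T *m v))^T.
  by rewrite !trmx_mul !trmxK.
rewrite !mulmxA.
move: (v^T *m H *m v) (y^T *m H *m v) (y^T *m H^T *m v) => B1 B2 B3.
move: (y^T *m H *m y) (v^T *m g) (y^T *m g) => B4 B5 B6.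
by rewrite !mxE; ring.
Qed.

(** * The Frobenius inner product *)

Definition frob A B : R := \tr (A^T *m B).

Lemma frobDl A1 A2 B : frob (A1 + A2) B = frob A1 B + frob A2 B.
Proof. by rewrite /frob linearD mulmxDl mxtraceD. Qed.

Lemma frobZl (c : R) A B : frob (c *: A) B = c * frob A B.
Proof. by rewrite /frob linearZ -scalemxAl mxtraceZ. Qed.

Lemma frobC A B : frob A B = frob B A.
Proof. by rewrite /frob -mxtrace_tr trmx_mul trmxK. Qed.

Lemma frobDr A B1 B2 : frob A (B1 + B2) = frob A B1 + frob A B2.
Proof. by rewrite !(frobC A) frobDl. Qed.

Lemma frob_sumZl (I : finType) (c : I -> R) (F : I -> 'M[R]_n) B :
  frob (\sum_i c i *: F i) B = \sum_i c i * frob (F i) B.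
Proof.
elim/big_ind2: _ => [|A1 s1 A2 s2 <- <-|i _]; rewrite ?frobDl ?frobZl//.
by rewrite /frob trmx0 mul0mx mxtrace0.
Qed.

(** Cyclicity of the trace. Pairing with a rank-one matrix thus becomes a quadratic form, which
    [quadratic_expand] relates to a point value. *)
Lemma frob_rank1 y B : frob (y *m y^T) B = (y^T *m B *m y) 0 0.
Proof.
rewrite /frob trmx_mul trmxK mxtrace_mulC mulmxA mxtrace_mulC mulmxA.
by rewrite trace_mx11.
Qed.

Lemma frobE A : frob A A = \sum_i \sum_j A i j ^+ 2.
Proof.
rewrite exchange_big; apply: eq_bigr => j _; rewrite mxE.
by apply: eq_bigr => i _; rewrite !mxE expr2.
Qed.

Lemma frob_ge0 A : 0 <= frob A A.
Proof. by rewrite frobE; do 2![apply: sumr_ge0 => ? _]; rewrite sqr_ge0. Qed.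

Lemma frob_eq0 A : frob A A = 0 -> A = 0.
Proof.
rewrite frobE => /eqP; rewrite psumr_eq0 => [/allP A0|i _]; last first.
  by apply: sumr_ge0 => j _; rewrite sqr_ge0.
apply/matrixP => i j; have := A0 i (mem_index_enum _).
rewrite psumr_eq0 => [/allP /(_ j (mem_index_enum _))|k _]; last exact: sqr_ge0.
by rewrite sqrf_eq0 mxE => /eqP.
Qed.

Lemma objectiveE P Q :
  objective P Q = frob (hessian Q 0 - hessian P 0) (hessian Q 0 - hessian P 0).
Proof. by rewrite /objective sqr_sqrtr -frobE// frob_ge0. Qed.

(** * Affine forms vanishing at a base point, and their squares *)

Section CenteredForm.
Variable v0 : 'cV[R]_n.

Definition centered_form b : {mpoly R[n]} :=
  \sum_k b k 0 *: ('X_k - (v0 k 0)%:MP).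

Lemma eval_centered_form b v : eval (centered_form b) v = (b^T *m (v - v0)) 0 0.
Proof.
rewrite eval_sum mxE; apply: eq_bigr => k _.
by rewrite evalZ evalB evalC /eval mevalXU !mxE.
Qed.

Lemma mderiv_centered_form b i : (centered_form b)^`M(i) = (b i 0)%:MP.
Proof.
rewrite /centered_form linear_sum (bigD1 i)//= big1 => [|k /negPf ki].
  by rewrite addr0 mderivZ mderivB mderivXU eqxx mderivC subr0 alg_mpolyC.
by rewrite mderivZ mderivB mderivXU eq_sym ki mderivC subr0 mpolyC0 scaler0.
Qed.

Lemma msize_centered_form b : (msize (centered_form b) <= 2)%N.
Proof.
rewrite (leq_trans (msize_sum _ _ _))//; apply/bigmax_leqP => k _.
rewrite (leq_trans (msizeZ_le _ _))// (leq_trans (msizeD_le _ _))//.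
by rewrite msizeN msizeX mdeg1 msizeC geq_max; case: (_ != 0).
Qed.

Lemma quadratic_centered_form_sqr b : quadratic (centered_form b ^+ 2).
Proof.
(* The exact size of a product requires nonzero factors, so the zero form is treated apart. *)
rewrite /quadratic expr2; have [->|q0] := eqVneq (centered_form b) 0.
  by rewrite mul0r msize0.
have := msize_centered_form b; rewrite msizeM//.
by case: (msize _) => [|[|[|//]]].
Qed.

Lemma hessian_centered_form_sqr b v :
  hessian (centered_form b ^+ 2) v = 2 *: (b *m b^T).
Proof.
apply/matrixP => i j; rewrite !mxE expr2 mderivM !mderiv_centered_form.
rewrite mderivD !mderivM !mderiv_centered_form mderivC.
rewrite big_ord1 !mxE mul0r mulr0 addr0 add0r evalD /eval.
by rewrite !mevalM !mevalC; ring.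
Qed.

Lemma hessian_centered_form b v : hessian (centered_form b) v = 0.
Proof.
by apply/matrixP => i j; rewrite !mxE mderiv_centered_form mderivC /eval meval0.
Qed.
End CenteredForm.
End QuadraticPolynomials.

(** * The optimality condition and the KKT system *)

Section LeastFrobenius.
Variables (R : realType) (n m : nat) (x : 'I_m -> 'cV[R]_n) (x0 : 'cV[R]_n).
Implicit Types (P Q Qa D : {mpoly R[n]}) (h : 'cV[R]_n -> R).

(** First-order optimality: the objective has zero derivative along every direction that preserves
    the interpolation conditions. *)
Definition stationary Qa Q := forall P, quadratic P ->
  interpolates x (fun=> 0) P ->
  frob (hessian Q 0 - hessian Qa 0) (hessian P 0) = 0.

Lemma kkt_X_trmx_mul a b i :
  ((kkt_X x x0)^T *m col_mx a%:M b) i 0 = a + ((x i - x0)^T *m b) 0 0.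
Proof.
have -> : a + ((x i - x0)^T *m b) 0 0 =
    ((col_mx 1%:M (x i - x0))^T *m col_mx a%:M b) 0 0.
  by rewrite tr_col_mx mul_row_col trmx1 mul1mx [RHS]mxE [a%:M _ _]mxE.
by rewrite !mxE; apply: eq_bigr => k _; rewrite !mxE.
Qed.

Hypothesis hx : poised x x0.

(** Padding [(a, b)] with zero multipliers gives a vector in the kernel of the invertible KKT
    matrix. *)
Lemma poised_vanish_affine (a : R) (b : 'cV[R]_n) :
  (forall i, a + ((x i - x0)^T *m b) 0 0 = 0) -> a = 0 /\ b = 0.
Proof.
move=> h0; have X0 : (kkt_X x x0)^T *m col_mx a%:M b = 0.
  by apply/colP => i; rewrite kkt_X_trmx_mul h0 mxE.
have : kkt_mx x x0 *m col_mx 0 (col_mx a%:M b) = 0.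
  by rewrite mul_block_col X0 !mulmx0 mul0mx !addr0 col_mx0.
move/(congr1 (mulmx (invmx (kkt_mx x x0)))); rewrite mulKmx// mulmx0.
move/eqP; rewrite col_mx_eq0 => /andP[_].
rewrite col_mx_eq0 => /andP[/eqP a0 /eqP->].
by split=> //; move/matrixP/(_ 0 0): a0; rewrite !mxE eqxx mulr1n.
Qed.

Lemma poised_vanish_eq0 P : quadratic P -> interpolates x (fun=> 0) P ->
  hessian P 0 = 0 -> P = 0.
Proof.
move=> qP P0 H0; have [a [b PE]] := quadratic_expand x0 qP.
have [a0 b0] : a = 0 /\ b = 0.
  apply: poised_vanish_affine => i.
  have := PE (x i - x0).
  by rewrite addrC subrK P0 H0 mulmx0 mul0mx [X in _ * X]mxE mulr0 addr0.
have {}PE v : eval P v = 0.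
  have := PE (v - x0); rewrite addrC subrK => ->.
  by rewrite a0 b0 H0 !mulmx0 !mul0mx [X in _ + X + _ * X]mxE mulr0 !addr0.
(* [P] now vanishes at every point; its value at the [i]-th basis vector isolates the [i]-th partial
   derivative. *)
have gE i : eval P^`M(i) 0 = 0.
  have := PE (delta_mx i 0); rewrite quadratic_evalE// PE H0 mulmx0 mul0mx.
  rewrite (bigD1 i)//= big1 => [|k ki]; last by rewrite mxE (negPf ki) mulr0.
  by rewrite !mxE !eqxx mulr1 mulr0 !addr0 add0r.
rewrite -(taylor2_quadratic qP) /taylor2 PE H0 mpolyC0 add0r.
rewrite big1 ?add0r => [|i _]; last by rewrite gE scale0r.
by rewrite big1 ?scaler0// => i _; rewrite big1// => j _; rewrite mxE scale0r.
Qed.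

Lemma stationary_model Qa h Q : quadratic Qa -> quadratic Q ->
  interpolates x h Q -> stationary Qa Q -> model x Qa h = Q.
Proof.
move=> qQa qQ hQ sQ.
have pyth Q' : quadratic Q' -> interpolates x h Q' ->
    objective Qa Q' =
      objective Qa Q + frob (hessian (Q' - Q) 0) (hessian (Q' - Q) 0).
  move=> qQ' hQ'; have Q0 : interpolates x (fun=> 0) (Q' - Q).
    by move=> i; rewrite evalB hQ hQ' subrr.
  have := sQ _ (quadraticB qQ' qQ) Q0; rewrite !objectiveE hessianB => sQ'.
  have -> : hessian Q' 0 - hessian Qa 0 =
      (hessian Q 0 - hessian Qa 0) + (hessian Q' 0 - hessian Q 0).
    by rewrite [RHS]addrC addrA subrK.
  move: (hessian Q 0 - _) (hessian Q' 0 - _) sQ' => U V UV.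
  by rewrite frobDl !frobDr (frobC V U) UV addr0 add0r.
have solQ : least_frobenius_solution x Qa h Q.
  by split=> // Q' qQ' hQ'; rewrite (pyth _ qQ' hQ') lerDl frob_ge0.
apply: xget_unique => // Q' [qQ' hQ' minQ'].
apply/eqP; rewrite -subr_eq0; apply/eqP; apply: poised_vanish_eq0.
- exact: quadraticB.
- by move=> i; rewrite evalB hQ hQ' subrr.
- apply: frob_eq0; apply/eqP; rewrite eq_le frob_ge0 andbT.
  (* Minimality of [Q'] tested against [Q] makes the extra Pythagorean term nonpositive. *)
  by have := minQ' Q qQ hQ; rewrite (pyth _ qQ' hQ') gerDl.
Qed.

(* [(l, a, b)] solves the KKT system: the multipliers [l] give the Hessian
   [\sum_i l_i (x_i - x0)(x_i - x0)^T] of the interpolant, and [(a, b)] its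
   affine part. *)
Lemma exists_stationary0 h :
  exists D, [/\ quadratic D, interpolates x h D & stationary 0 D].
Proof.
pose w := invmx (kkt_mx x x0) *m col_mx (\col_i h (x i)) 0.
pose l := usubmx w; pose c := dsubmx w.
pose a := (usubmx c) 0 0; pose b := dsubmx c.
have cE : c = col_mx a%:M b by rewrite -mx11_scalar vsubmxK.
have : kkt_mx x x0 *m col_mx l c = col_mx (\col_i h (x i)) 0.
  by rewrite vsubmxK mulKVmx.
rewrite mul_block_col mul0mx addr0 => /eq_col_mx[hE Xl0].
(* The square of a form with coefficients [b] has Hessian [2 *: (b *m b^T)], hence the factor
   1/2. *)
pose D := a%:MP + centered_form x0 b
  + 2^-1 *: \sum_i l i 0 *: centered_form x0 (x i - x0) ^+ 2.
have HD : hessian D 0 = \sum_i l i 0 *: ((x i - x0) *m (x i - x0)^T).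
  rewrite !hessianD hessianC hessian_centered_form hessianZ hessian_sum !add0r.
  rewrite scaler_sumr; apply: eq_bigr => i _.
  rewrite hessianZ hessian_centered_form_sqr !scalerA; congr (_ *: _).
  by field.
exists D; split.
- rewrite !quadraticD ?quadraticC ?quadraticZ//.
    exact: leq_trans (msize_centered_form _ _) _.
  elim/big_ind: _ => [|P Q|i _]; first by rewrite -mpolyC0 quadraticC.
    exact: quadraticD.
  exact/quadraticZ/quadratic_centered_form_sqr.
(* Row [i] of the first block equation is interpolation at [x i]: the [kkt_X] term is the affine
   part of [D], and the [kkt_A] term its quadratic part, with the same factor 1/2. *)
- move=> i; have := congr1 (fun M : 'cV_m => M i 0) hE.
  rewrite cE [in LHS]mxE [RHS]mxE kkt_X_trmx_mul => <-.
  rewrite !evalD evalC eval_centered_form evalZ eval_sum [LHS]addrC.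
  congr (_ + (_ + _)).
    rewrite [RHS]mxE mulr_sumr; apply: eq_bigr => j _.
    rewrite evalZ [kkt_A _ _ _ _]mxE expr2 /eval mevalM -/(eval _ _).
    rewrite eval_centered_form -(trmx11E (_^T *m _)) trmx_mul trmxK expr2.
    by ring.
  by rewrite -trmx11E trmx_mul trmxK.
- move=> P qP P0; have [a' [b' PE]] := quadratic_expand x0 qP.
  rewrite hessian0 subr0 HD frob_sumZl.
  (* Since [P] vanishes at [x i], its Hessian form at [x i - x0] is -2 times its affine part there.
     The sum weighted by [l] is then zero by the second block equation [Xl0]. *)
  transitivity (- 2 * (l^T *m ((kkt_X x x0)^T *m col_mx a'%:M b')) 0 0);
    last first.
    by rewrite mulmxA -trmx_mul Xl0 trmx0 mul0mx mxE mulr0.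
  rewrite mxE mulr_sumr; apply: eq_bigr => i _.
  rewrite frob_rank1 kkt_X_trmx_mul [l^T _ _]mxE.
  have := PE (x i - x0); rewrite addrC subrK P0 => PE0.
  have -> : ((x i - x0)^T *m hessian P 0 *m (x i - x0)) 0 0 =
     - 2 * (a' + ((x i - x0)^T *m b') 0 0) by lra.
  by ring.
Qed.

(** Translation by [Qa] reduces to base zero: interpolate [h - Qa], then add [Qa] back. *)
Lemma exists_stationary Qa h : quadratic Qa ->
  exists Q, [/\ quadratic Q, interpolates x h Q & stationary Qa Q].
Proof.
move=> qQa; have [D [qD hD sD]] :=
  exists_stationary0 (fun v => h v - eval Qa v).
exists (D + Qa); split.
- exact: quadraticD.
- by move=> i; rewrite evalD hD subrK.
- move=> P qP P0; have := sD P qP P0.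
  by rewrite hessianD addrK hessian0 subr0.
Qed.

(** A stationary interpolant exists and equals the model, so the default value of [xget] does not
    interfere. *)
Lemma model_spec Qa h : quadratic Qa ->
  [/\ quadratic (model x Qa h), interpolates x h (model x Qa h)
    & stationary Qa (model x Qa h)].
Proof.
move=> qQa; have [Q [qQ hQ sQ]] := exists_stationary h qQa.
by rewrite (stationary_model qQa qQ hQ sQ).
Qed.
End LeastFrobenius.

(** * Behaviour of the model under an affine change of values *)

Theorem theorem4 (R : realType) (n m : nat) (f : 'cV[R]_n -> R)
    (Qa : {mpoly R[n]}) (hQa : quadratic Qa)
    (x : 'I_m -> 'cV[R]_n) (x0 : 'cV[R]_n) (hx : poised x x0)
    (hm1 : (n + 1 <= m)%N) (hm2 : (m < ((n + 1) * (n + 2)) %/ 2)%N)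
    (C1 C2 : R) :
  model x Qa (fun v => C1 * f v + C2) =
    (C1 *: model x Qa f + C2%:MP) +
    (C1 - 1) *: (model x 0 (eval Qa) - Qa).
Proof.
have [q1 h1 s1] := model_spec hx f hQa.
have q0 : quadratic (0 : {mpoly R[n]}) by rewrite -mpolyC0 quadraticC.
have [q2 h2 s2] := model_spec hx (eval Qa) q0.
apply: (stationary_model hx) => //.
- by rewrite !quadraticD ?quadraticZ ?quadraticC ?quadraticB.
(* The correction term vanishes at the points, where [model x 0 (eval Qa)] agrees with [Qa]. *)
- by move=> i; rewrite !(evalB, evalD, evalZ, evalC) h1 h2 subrr mulr0 addr0.
- move=> P qP P0; have := s2 P qP P0; have := s1 P qP P0.
  rewrite hessian0 subr0.
  rewrite !(hessianB, hessianD, hessianZ, hessianC) addr0.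
  move: (hessian (model x Qa f) 0) (hessian (model x 0 _) 0) => H1 H2.
  move: (hessian Qa 0) => Ha e1 e2.
  (* Regrouping the copies of [Ha] leaves a combination of the two Hessian differences known to be
     orthogonal to that of [P]. *)
  have -> : C1 *: H1 + (C1 - 1) *: (H2 - Ha) - Ha =
      C1 *: (H1 - Ha) + (C1 - 1) *: H2.
    by apply/matrixP => i j; rewrite !mxE; ring.
  by rewrite frobDl !frobZl e1 e2 !mulr0 addr0.
Qed.
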